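(* For every positive integer $n$, the number of partitions $(m_1,\dots,m_r)$ of $n$ (written with $m_1\le m_2\le\dots\le m_r$, $m_1+\dots+m_r=n$) into positive integer parts different from $2$ such that $m_{i+1}-m_i\ge 5$ for all $1\le i\le r-1$, and such that for all $1\le i\le r-1$ $$m_{i+1}-m_i=5\ \Rightarrow\ m_{i+1}+m_i\not\equiv \pm 1,\pm 5,\pm 7 \pmod{16},$$ $$m_{i+1}-m_i=6\ \Rightarrow\ m_{i+1}+m_i\not\equiv \pm 2,\pm 6 \pmod{16},$$ $$m_{i+1}-m_i=7\ \Rightarrow\ m_{i+1}+m_i\not\equiv \pm 3 \pmod{16},$$ $$m_{i+1}-m_i=8\ \Rightarrow\ m_{i+1}+m_i\not\equiv \pm 4 \pmod{16},$$ is equal to the number of partitions of $n$ into distinct odd parts.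
   Context: Partitions are finite sequences of positive integers listed in increasing order. *)

(* Defs.v *)
From HB Require Import structures.
From mathcomp Require Import all_boot.

Set Implicit Arguments.
Unset Strict Implicit.
Unset Printing Implicit Defensive.

Definition is_intpart (n : nat) (s : seq nat) : bool :=
  [&& sorted leq s, all (leq 1) s & sumn s == n].

Record intpart (n : nat) : Type := Intpart {
  parts :> seq nat;
  _ : is_intpart n parts
}.

HB.instance Definition _ (n : nat) := [isSub of intpart n for @parts n].
HB.instance Definition _ (n : nat) := [Countable of intpart n by <:].

(* A partition of n has at most n parts, each at most n; [intpart n] is a
   [finType] by embedding it into sequences over 'I_n.+1 of length <= n. *)
Section IntpartFinite.

Variable n : nat.

Definition intpart_code (p : intpart n) : option (n.-bseq 'I_n.+1) :=
  insub (map inord p).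

Definition intpart_decode (b : option (n.-bseq 'I_n.+1)) : option (intpart n) :=
  obind (fun s : n.-bseq 'I_n.+1 => insub (map val s)) b.

Lemma intpart_codeK : pcancel intpart_code intpart_decode.
Proof.
case=> s sP; rewrite /intpart_code /=.
have /and3P[_ pos_s /eqP sum_s] := sP.
have size_s : size s <= n.
  rewrite -sum_s; elim: s pos_s {sP sum_s} => //= x s IHs /andP[x0 /IHs].
  by rewrite -add1n; apply: leq_add.
have s_le x : x \in s -> x <= n.
  rewrite -sum_s; elim: s {pos_s sP sum_s size_s} => //= y s IHs.
  rewrite inE => /predU1P[->|/IHs xs]; first exact: leq_addr.
  exact: leq_trans xs (leq_addl _ _).
rewrite insubT ?size_map //= => size_s'; rewrite -map_comp map_id_in.
  by rewrite (insubT (is_intpart n) sP).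
by move=> x /s_le xn /=; rewrite inordK.
Qed.

HB.instance Definition _ : isFinite (intpart n) := PCanIsFinite intpart_codeK.

End IntpartFinite.

(* s is congruent to k or to -k modulo 16 *)
Definition eqpm16 (s k : nat) : bool :=
  (s == k %[mod 16]) || (s + k == 0 %[mod 16]).

(* The condition on consecutive parts a = m_i, b = m_{i+1}; the inequality
   a + 5 <= b makes the truncated subtraction b - a a true difference. *)
Definition gap_cond (a b : nat) : bool :=
  [&& a + 5 <= b,
      (b - a == 5) ==>
        [&& ~~ eqpm16 (b + a) 1, ~~ eqpm16 (b + a) 5 & ~~ eqpm16 (b + a) 7],
      (b - a == 6) ==> ~~ eqpm16 (b + a) 2 && ~~ eqpm16 (b + a) 6,
      (b - a == 7) ==> ~~ eqpm16 (b + a) 3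
    & (b - a == 8) ==> ~~ eqpm16 (b + a) 4].

Definition gap_partition (s : seq nat) : bool :=
  (2 \notin s) && sorted gap_cond s.

Definition distinct_odd (s : seq nat) : bool :=
  uniq s && all odd s.

(* Main.v *)
Require Import Defs.
From mathcomp Require Import all_boot.
From mathcomp Require Import ssralg poly ssrint ring zify.

Set Implicit Arguments.
Unset Strict Implicit.
Unset Printing Implicit Defensive.

Import GRing.Theory.

(** Let F_N(x, y) be the generating function of the gap partitions with parts
    at most N, where a part p has weight x^p y if p is odd and x^p y^2 if p is
    even: even parts behave like sums of two odd parts.  Conditioning on the
    largest part gives linear recurrences for F_N depending only on N mod 8,
    and by induction on j they imply
      F_(8j+4)(x, y) = (1 + x y) F_(8j+1)(x, x^2 y).
    Iterating y -> x^2 y from y = 1 produces the factors 1 + x^(2i+1), while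
    the coefficient of x^n in F_N does not depend on N >= n. *)

(** * Enumeration of strictly increasing sequences *)

(** Splitting on the presence of the largest value, placed last, makes generating functions over
    this list satisfy a recurrence in [N]. *)
Fixpoint incseqs (N : nat) : seq (seq nat) :=
  if N is M.+1 then incseqs M ++ [seq rcons s N | s <- incseqs M]
  else [:: [::]].

Lemma incseqsP (N : nat) (s : seq nat) :
  (s \in incseqs N) = sorted ltn s && all (fun p => 0 < p <= N) s.
Proof.
elim: N s => [|N IHN] s.
  by rewrite inE; case: s => [|[|p] s]; rewrite //= andbF.
rewrite mem_cat IHN; apply/orP/idP => [[|/mapP[t]]|].
- case/andP=> -> /allP sN; apply/allP => p /sN /andP[-> pN].
  exact: leqW.
- rewrite IHN => /andP[tP /allP tN] ->; rewrite all_rcons leqnn /=.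
  apply/andP; split.
    case: t tP tN => //= p t tP tN; rewrite rcons_path tP /=.
    by have /andP[] := tN _ (mem_last p t).
  by apply/allP => p /tN /andP[-> pN]; exact: leqW.
- case/andP; case/lastP: s => [|s p]; first by left.
  rewrite all_rcons => sP /andP[/andP[p0 pN] sN].
  have sortS : sorted ltn s.
    by case: s sP {sN} => //= q s; rewrite rcons_path => /andP[].
  have sp q : q \in s -> q < p.
    have := sP; rewrite -cats1 (sorted_pairwise ltn_trans) pairwise_cat.
    by case/and3P => /allrelP + _ _ qs; apply; rewrite ?inE.
  have [pE|ltpN] := eqVneq p N.+1.
    right; apply/mapP; exists s; rewrite ?pE // IHN sortS.
    apply/allP => q qs; have /andP[-> _] := allP sN _ qs.
    by have := sp _ qs; rewrite pE ltnS.
  have {ltpN} pN' : p <= N by rewrite -ltnS ltn_neqAle ltpN.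
  left; rewrite sP all_rcons p0 pN' /=; apply/allP => q qs.
  have /andP[-> _] := allP sN _ qs.
  exact: leq_trans (ltnW (sp _ qs)) pN'.
Qed.

Lemma incseqs_uniq (N : nat) : uniq (incseqs N).
Proof.
elim: N => //= N IHN; rewrite cat_uniq IHN (map_inj_uniq (rcons_injl _)) IHN.
rewrite andbT; apply/hasPn => _ /mapP[s _ ->].
by rewrite incseqsP all_rcons ltnn !andbF.
Qed.

Lemma intpart_incseqs (n : nat) (s : seq nat) :
  is_intpart n s && uniq s = (s \in incseqs n) && (sumn s == n).
Proof.
rewrite incseqsP ltn_sorted_uniq_leq /is_intpart.
have [<-|_] := eqVneq (sumn s) n; last by rewrite !andbF.
rewrite !andbT andbAC (andbC (sorted _ _)); congr andb.
apply: eq_in_all => p ps; rewrite -[LHS]andbT; congr andb; symmetry.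
elim: s ps => //= q s IHs; rewrite inE => /predU1P[->|/IHs ps].
  by rewrite leq_addr.
by rewrite (leq_trans ps) ?leq_addl.
Qed.

(** Each partition of [n] into distinct parts occurs exactly once in [incseqs n], so cardinalities
    become counts over a list. *)
Lemma card_strict_intpart (n : nat) (P : pred (seq nat)) :
  (forall p : intpart n, P p -> uniq p) ->
  #|[set p : intpart n | P p]|
  = count (fun s => P s && (sumn s == n)) (incseqs n).
Proof.
move=> P_uniq; rewrite cardE -(size_map val) -size_filter.
apply/perm_size/uniq_perm.
- by rewrite (map_inj_uniq val_inj) enum_uniq.
- by rewrite filter_uniq ?incseqs_uniq.
move=> s; rewrite mem_filter; apply/mapP/idP => [[p]|/andP[/andP[Ps sn] sinc]].
  rewrite mem_enum inE => Pp ->; rewrite Pp /= andbC -intpart_incseqs.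
  by rewrite P_uniq // (valP p).
have /andP[sP _] : is_intpart n s && uniq s by rewrite intpart_incseqs sinc sn.
by exists (Intpart sP); rewrite // mem_enum inE.
Qed.

(** * Periodicity of the gap condition *)

Lemma gap_cond_far (a b : nat) : a + 9 <= b -> gap_cond a b.
Proof.
move=> ab; rewrite /gap_cond.
have -> : a + 5 <= b by lia.
have -> : (b - a == 5) = false by lia.
have -> : (b - a == 6) = false by lia.
have -> : (b - a == 7) = false by lia.
by have -> : (b - a == 8) = false by lia.
Qed.

(** The difference is unchanged and the sum moves by [16 * j]; this is the source of the period 8 in
    the recurrences. *)
Lemma gap_condD8 (j a b : nat) : gap_cond (8 * j + a) (8 * j + b) = gap_cond a b.
Proof.
have eqpm16D s k : eqpm16 (16 * j + s) k = eqpm16 s k.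
  by rewrite /eqpm16 -addnA mulnC !modnMDl.
have sumE : 8 * j + b + (8 * j + a) = 16 * j + (b + a) by lia.
by rewrite /gap_cond subnDl -addnA leq_add2l sumE !eqpm16D.
Qed.

(** For [r < 8 * j] the gap is at least 9; periodicity reduces the other cases to a finite check. *)
Lemma gap_cond_below (j c n : nat) : 8 <= c -> all (gap_cond^~ c) (iota 0 n.+1) ->
  forall r, r <= 8 * j + n -> gap_cond r (8 * j + c).
Proof.
move=> c8 /allP ok r rn; have [rj|jr] := ltnP r (8 * j).
  by apply: gap_cond_far; lia.
by rewrite -(subnKC jr) gap_condD8 ok // mem_iota; lia.
Qed.

Lemma gap_cond_above (j c n m : nat) :
    all (fun t => ~~ gap_cond t c) (iota n.+1 (m - n)) ->
  forall r, 8 * j + n < r <= 8 * j + m -> ~~ gap_cond r (8 * j + c).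
Proof.
move=> /allP no r rnm; have jr : 8 * j <= r by lia.
by rewrite -(subnKC jr) gap_condD8 no // mem_iota; lia.
Qed.

Local Open Scope ring_scope.

(** * Weighted generating functions *)

Section Weighted.

Variables (R : comNzRingType) (x y : R).

Definition wt (p : nat) : R := x ^+ p * (if odd p then y else y ^+ 2).

Definition swt (s : seq nat) : R := \prod_(p <- s) wt p.

Definition gf (P : pred (seq nat)) (N : nat) : R :=
  \sum_(s <- incseqs N | P s) swt s.

Lemma gf0 (P : pred (seq nat)) : gf P 0 = (P [::])%:R.
Proof.
rewrite /gf /= big_cons big_nil addr0 /swt big_nil.
by case: (P [::]).
Qed.

Lemma gfS (P : pred (seq nat)) (N : nat) :
  gf P N.+1 = gf P N + wt N.+1 * gf (fun s => P (rcons s N.+1)) N.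
Proof.
rewrite /gf big_cat big_map /=; congr (_ + _); rewrite big_distrr /=.
by apply: eq_bigr => s _; rewrite /swt big_rcons /= mulrC.
Qed.

Lemma eq_gf (P P' : pred (seq nat)) (N : nat) : P =1 P' -> gf P N = gf P' N.
Proof. by move=> eqP; apply: eq_bigl. Qed.

Lemma gf_false (N : nat) : gf (fun=> false) N = 0.
Proof. exact: big_pred0_eq. Qed.

Definition gapgf (N : nat) : R := gf gap_partition N.

(** The last part [p] constrains the sequence, but its weight is left out. *)
Definition precgf (p N : nat) : R := gf (fun s => gap_partition (rcons s p)) N.

Lemma gapgf0 : gapgf 0 = 1.
Proof. by rewrite /gapgf gf0 /= mulr1n. Qed.

Lemma gapgfS (N : nat) : gapgf N.+1 = gapgf N + wt N.+1 * precgf N.+1 N.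
Proof. exact: gfS. Qed.

Lemma precgf0 (p : nat) : p != 2 -> precgf p 0 = 1.
Proof.
by move=> p2; rewrite /precgf gf0 /gap_partition /= inE eq_sym p2.
Qed.

Lemma gap_partition_rcons2 (s : seq nat) (q p : nat) :
  gap_partition (rcons (rcons s q) p)
  = [&& p != 2, gap_cond q p & gap_partition (rcons s q)].
Proof.
have sorted2 : sorted gap_cond (rcons (rcons s q) p)
    = gap_cond q p && sorted gap_cond (rcons s q).
  case: s => [|r s]; first by [].
  by rewrite /= rcons_path last_rcons andbC.
rewrite /gap_partition sorted2 mem_rcons inE negb_or eq_sym.
by rewrite -andbA; congr andb; exact: andbCA.
Qed.

Lemma precgf2 (N : nat) : precgf 2 N = 0.
Proof.
rewrite -(gf_false N); apply: eq_gf => s.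
by rewrite /gap_partition mem_rcons inE.
Qed.

(** The difference [gapgf N.+1 - gapgf N] weighs the gap partitions with largest part [N.+1]; all or
    none of them may precede [p]. *)
Lemma precgfS (p N : nat) : p != 2 ->
  precgf p N.+1 = precgf p N + (gap_cond N.+1 p)%:R * (gapgf N.+1 - gapgf N).
Proof.
move=> p2; rewrite gapgfS [gapgf N + _]addrC addrK /precgf gfS; congr (_ + _).
under [in LHS]eq_gf => s do rewrite gap_partition_rcons2 p2 /=.
by case: gap_cond => /=; rewrite ?mul1r // mul0r gf_false mulr0.
Qed.

Lemma precgf_prefix (p N : nat) : p != 2 ->
  (forall r, 0 < r <= N -> gap_cond r p)%N -> precgf p N = gapgf N.
Proof.
move=> p2; elim: N => [|N IHN] ok; first by rewrite precgf0 // gapgf0.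
rewrite precgfS // ok ?leqnn // IHN => [|r /andP[r0 rN]].
  by rewrite mul1r addrC subrK.
by rewrite ok // r0 leqW.
Qed.

Lemma precgf_stop (p N M : nat) : p != 2 -> (N <= M)%N ->
  (forall r, N < r <= M -> ~~ gap_cond r p)%N -> precgf p M = precgf p N.
Proof.
move=> p2 /subnKC <-; elim: (M - N)%N => [|k IHk] no; first by rewrite addn0.
rewrite addnS precgfS // (negPf (no _ _)) ?mul0r ?addr0; last by lia.
by apply: IHk => r rN; apply: no; lia.
Qed.

(** * Recurrences modulo 8 *)

Lemma gapgf_block0 :
  [/\ gapgf 1 = 1 + wt 1,
      gapgf 2 = gapgf 1 /\ gapgf 3 = gapgf 2 + wt 3,
      gapgf 4 = gapgf 3 + wt 4,
      gapgf 5 = gapgf 4 + wt 5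
    & gapgf 6 = gapgf 5 + wt 6 /\ gapgf 7 = gapgf 6 + wt 7 * gapgf 1].
Proof.
(* No positive part may precede a part below 7, so only the empty sequence counts. *)
have precgf_1 p : p != 2 -> (p < 7)%N -> precgf p p.-1 = 1.
  move=> p2 p7; rewrite (@precgf_stop _ 0) ?precgf0 // => r rp.
  by case: p r rp p7 {p2} => [|[|[|[|[|[|[|p]]]]]]] // [|[|[|[|[|[|[|r]]]]]]].
split; first by rewrite gapgfS gapgf0 (precgf_1 1%N) ?mulr1.
- by split; rewrite gapgfS ?precgf2 ?mulr0 ?addr0 // (precgf_1 3) ?mulr1.
- by rewrite gapgfS (precgf_1 4) ?mulr1.
- by rewrite gapgfS (precgf_1 5) ?mulr1.
split; first by rewrite gapgfS (precgf_1 6) ?mulr1.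
rewrite gapgfS (@precgf_stop _ 1) ?precgf_prefix //.
  by case=> [|[|r]].
by case=> [|[|[|[|[|[|[|r]]]]]]].
Qed.

(* Total weight of what may precede a last part 8j+4, 8j+5 or 8j+6: anything
   with parts at most 8(j-1)+7 whose last part is not 8(j-1)+6. *)
Definition holegf (j : nat) : R :=
  if j is i.+1 then gapgf (8 * i + 5) + gapgf (8 * i + 7) - gapgf (8 * i + 6) else 1.

(** The possible predecessors of [8 * j + c] are exactly the parts up to [8 * j + n]. For concrete
    [c] and [n] the hypotheses hold by computation. *)
Lemma gapgf_step (j c n : nat) : (8 <= c)%N -> (n < c)%N ->
    all (gap_cond^~ c) (iota 0 n.+1) ->
    all (fun t => ~~ gap_cond t c) (iota n.+1 (c.-1 - n)) ->
  gapgf (8 * j + c) = gapgf (8 * j + c.-1) + wt (8 * j + c) * gapgf (8 * j + n).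
Proof.
move=> c8 nc ok no; have c0 : (8 * j + c = (8 * j + c.-1).+1)%N by lia.
have p2 : (8 * j + c)%N != 2 by lia.
rewrite {1}c0 gapgfS -c0 (@precgf_stop _ (8 * j + n)) //; first last.
- exact: gap_cond_above.
- by lia.
by rewrite precgf_prefix // => r /andP[_]; exact: gap_cond_below.
Qed.

(** Here [8 * j + n.+1] is forbidden but [8 * j + n.+2] is allowed, which adds the difference of two
    consecutive [gapgf] values. *)
Lemma gapgf_step_hole (j c n : nat) : (8 <= c)%N -> (n.+2 < c)%N ->
    all (gap_cond^~ c) (iota 0 n.+1) ->
    ~~ gap_cond n.+1 c -> gap_cond n.+2 c ->
    all (fun t => ~~ gap_cond t c) (iota n.+3 (c.-1 - n.+2)) ->
  gapgf (8 * j + c) = gapgf (8 * j + c.-1) + wt (8 * j + c) *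
    (gapgf (8 * j + n) + gapgf (8 * j + n.+2) - gapgf (8 * j + n.+1)).
Proof.
move=> c8 nc ok no1 ok2 no; have c0 : (8 * j + c = (8 * j + c.-1).+1)%N by lia.
have p2 : (8 * j + c)%N != 2 by lia.
rewrite {1}c0 gapgfS -c0 (@precgf_stop _ (8 * j + n.+2)) //; first last.
- exact: gap_cond_above.
- by lia.
rewrite !addnS !precgfS // -!addnS !gap_condD8 ok2 (negPf no1) mul0r addr0 mul1r.
rewrite precgf_prefix ?addrA // => r /andP[_]; exact: gap_cond_below.
Qed.

Lemma gapgf_low (j : nat) :
  [/\ gapgf (8 * j + 4) = gapgf (8 * j + 3) + wt (8 * j + 4) * holegf j,
      gapgf (8 * j + 5) = gapgf (8 * j + 4) + wt (8 * j + 5) * holegf j,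
      gapgf (8 * j + 6) = gapgf (8 * j + 5) + wt (8 * j + 6) * holegf j
    & gapgf (8 * j + 7) = gapgf (8 * j + 6) + wt (8 * j + 7) * gapgf (8 * j + 1)].
Proof.
case: j => [|j].
  by rewrite muln0 !add0n /holegf !mulr1; case: gapgf_block0 => _ _ -> -> [-> ->].
(* Writing [8 * j.+1 + i] as [8 * j + (8 + i)] meets the bound [8 <= c]. *)
rewrite mulnS [(8 + _)%N]addnC -![(8 * j + 8 + _)%N]addnA.
by split; [exact: gapgf_step_hole..|exact: gapgf_step].
Qed.

Lemma gapgf_high (j : nat) :
  [/\ gapgf (8 * j + 8) = gapgf (8 * j + 7) + wt (8 * j + 8) * gapgf (8 * j + 1),
      gapgf (8 * j + 9) = gapgf (8 * j + 8) + wt (8 * j + 9) * gapgf (8 * j + 4),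
      gapgf (8 * j + 10) = gapgf (8 * j + 9) + wt (8 * j + 10) * gapgf (8 * j + 1)
    & gapgf (8 * j + 11) = gapgf (8 * j + 10) + wt (8 * j + 11) * gapgf (8 * j + 5)].
Proof. by split; apply: gapgf_step. Qed.

(** Isolates [x ^+ (8 * j)] as an atom for [ring] and makes the parity computable. *)
Lemma wtD8 (j i : nat) :
  wt (8 * j + i) = x ^+ (8 * j) * x ^+ i * (if odd i then y else y ^+ 2).
Proof. by rewrite /wt exprD oddD oddM. Qed.

End Weighted.

(** * The functional equation in y *)

(* The first, third and fourth equations only serve to make the induction work. *)
Lemma gapgf_shift_block (R : comNzRingType) (x y z : R) (j : nat) :
    z = x ^+ 2 * y ->
  [/\ gapgf x y (8 * j + 1) = (1 + x * y) * holegf x z j,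
      gapgf x y (8 * j + 4) = (1 + x * y) * gapgf x z (8 * j + 1),
      gapgf x y (8 * j + 5) = gapgf x z (8 * j + 5) + x * y * gapgf x z (8 * j + 1)
                          - wt x y (8 * j + 7) * gapgf x y (8 * j + 1)
    & gapgf x y (8 * j + 6) = (1 + x * y) * gapgf x z (8 * j + 3)].
Proof.
move=> zE; elim: j => [|j [IH1 IH4 IH5 IH6]].
  have [G1 [G2 G3] G4 G5 [G6 _]] := gapgf_block0 x y.
  have [H1 [H2 H3] H4 H5 _] := gapgf_block0 x z.
  rewrite muln0 !add0n /holegf G6 G5 G4 G3 G2 G1 H5 H4 H3 H2 H1 /wt /= zE.
  by split; ring.
have [_ _ _ G7] := gapgf_low x y j.
have [G8 G9 G10 G11] := gapgf_high x y j.
have [G12 G13 G14 _] := gapgf_low x y j.+1.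
have [H4 H5 H6 H7] := gapgf_low x z j.
have [H8 H9 H10 H11] := gapgf_high x z j.
have [H12 H13 _ _] := gapgf_low x z j.+1.
have shiftE i : (8 * j.+1 + i = 8 * j + (8 + i))%N by lia.
rewrite !shiftE !addSn !add0n in G12 G13 G14 H12 H13 *.
(* Everything unrolls to [holegf x z j], [gapgf x z (8 * j + 1)], [gapgf x z (8 * j + 3)] and
   weights, leaving polynomial identities. *)
rewrite G14 G13 G12 G11 G10 G9 G8 H13 H12 H11 H10 H9 H8 /holegf.
rewrite G7 H7 H6 IH5 IH6 IH4 IH1 H5 H4 !wtD8 /= zE.
by split; ring.
Qed.

Lemma gapgf_shift (R : comNzRingType) (x y : R) (j : nat) :
  gapgf x y (8 * j + 4) = (1 + x * y) * gapgf x (x ^+ 2 * y) (8 * j + 1).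
Proof. by have [] := gapgf_shift_block j (erefl (x ^+ 2 * y)). Qed.

(** * Extraction of coefficients *)

(** Every weight has a factor [y], so a part above [N] contributes only in degrees above
    [N + 2 * k]. *)
Lemma coef_gf_stable (P : pred (seq nat)) (Q : {poly int}) (k n N M : nat) :
  (n <= N + 2 * k)%N -> (N <= M)%N ->
  (Q * gf 'X 'X^(2 * k) P M)`_n = (Q * gf 'X 'X^(2 * k) P N)`_n.
Proof.
move=> nN /subnKC <-; elim: (M - N)%N => [|i IHi]; first by rewrite addn0.
rewrite addnS gfS mulrDr coefD IHi mulrCA -mulrA /wt.
have -> : (if odd (N + i).+1 then 'X^(2 * k) else 'X^(2 * k) ^+ 2)
    = 'X^(2 * k) * (if odd (N + i).+1 then 1 else 'X^(2 * k)) :> {poly int}.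
  by case: odd; rewrite ?mulr1 ?expr2.
rewrite -!mulrA mulrA -exprD coefXnM ifT ?addr0 //; lia.
Qed.

Lemma coef_gapgf (n : nat) :
  (gapgf 'X 1 n : {poly int})`_n
  = (\prod_(i < n) (1 + 'X^(2 * i + 1)) : {poly int})`_n.
Proof.
suff main K N : (n <= N)%N -> (gapgf 'X 1 n : {poly int})`_n
    = ((\prod_(i < K) (1 + 'X^(2 * i + 1))) * gapgf 'X 'X^(2 * K) N : {poly int})`_n.
  (* After [n] shifts, [n <= 0 + 2 * n] allows truncation to index 0, where the series is 1. *)
  by rewrite (main n n) // (@coef_gf_stable _ _ n n 0) ?gf0 ?mulr1 //; lia.
elim: K N => [|K IHK] N nN.
  have := @coef_gf_stable gap_partition 1 0 n n N.
  by rewrite big_ord0 !mul1r addn0 => ->.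
(* This index fits the shift, which leaves [8 * N + 1]; stability brings it back to [N]. *)
rewrite (IHK (8 * N + 4)%N); last by lia.
rewrite gapgf_shift -exprD -exprS mulrA big_ord_recr /= !addn1.
rewrite (_ : (2 + 2 * K = 2 * K.+1)%N); last by lia.
by apply: coef_gf_stable; lia.
Qed.

(** Each step adds the odd part [2 * K + 1], giving the new factor, and an even part contributing
    nothing. *)
Lemma gf_odd (R : comNzRingType) (x : R) (K : nat) :
  gf x 1 (all odd) (2 * K) = \prod_(i < K) (1 + x ^+ (2 * i + 1)).
Proof.
elim: K => [|K IHK]; first by rewrite gf0 big_ord0.
rewrite big_ord_recr /= -IHK (_ : (2 * K.+1 = (2 * K).+2)%N); last by lia.
rewrite gfS [Y in _ + _ * Y](_ : _ = 0) ?mulr0 ?addr0; last first.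
  rewrite -(gf_false x 1 (2 * K).+1); apply: eq_gf => s.
  by rewrite all_rcons /= oddM.
rewrite gfS /wt addn1 /= oddM /= mulr1 (@eq_gf _ _ _ _ (all odd)).
  by rewrite mulrDr mulr1 mulrC.
by move=> s; rewrite all_rcons /= oddM.
Qed.

Lemma coef_gf (P : pred (seq nat)) (n N : nat) :
  (gf 'X 1 P N : {poly int})`_n
  = (count (fun s => P s && (sumn s == n)) (incseqs N))%:R.
Proof.
have swtE s : swt 'X 1 s = 'X^(sumn s) :> {poly int}.
  rewrite /swt; elim: s => [|p s IHs]; first by rewrite big_nil.
  by rewrite big_cons IHs /wt expr1n if_same mulr1 -exprD.
rewrite /gf coef_sum -sum1_count natr_sum big_mkcond [RHS]big_mkcond /=.
apply: eq_bigr => s _; rewrite swtE coefXn eq_sym.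
by case: (P s); case: eqP.
Qed.

Local Close Scope ring_scope.

(** * Comparison of the two counts *)

Theorem theoremA (n : nat) (hn : 0 < n) :
  #|[set p : intpart n | gap_partition p]|
  = #|[set p : intpart n | distinct_odd p]|.
Proof.
rewrite !card_strict_intpart; first last.
- move=> p /andP[_ sp]; apply: (sorted_uniq ltn_trans ltnn).
  by apply: sub_sorted sp => a b /andP[]; lia.
- by move=> p /andP[].
have -> : count (fun s => distinct_odd s && (sumn s == n)) (incseqs n)
    = count (fun s => all odd s && (sumn s == n)) (incseqs n).
  apply: eq_in_count => s; rewrite incseqsP ltn_sorted_uniq_leq.
  by rewrite /distinct_odd => /andP[/andP[-> _] _].
have := coef_gapgf n; rewrite -gf_odd /gapgf.
(* The product of [n] factors allows parts up to [2 * n]; the count uses parts up to [n], with the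
   same coefficient in degree [n]. *)
have := @coef_gf_stable (all odd) 1 0 n n (2 * n).
rewrite !mul1r => ->; [|lia|lia].
by rewrite !coef_gf !natz => -[].
Qed.
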